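(* The following properties hold. (Post-processing) If $\mathcal{A}$ is $(\epsilon,\delta)$-differentially private and $\mathcal{N}$ is an arbitrary quantum channel (whose input space is the output space of $\mathcal{A}$), then $\mathcal{N}\circ\mathcal{A}$ is also $(\epsilon,\delta)$-differentially private. (Parallel composition) Let $\mathcal{A}_1$ be $(\epsilon_1,\delta_1)$-differentially private and $\mathcal{A}_2$ be $(\epsilon_2,\delta_2)$-differentially private. Define $\rho_1\otimes\rho_2\sim\sigma_1\otimes\sigma_2$ if $\rho_1\sim\sigma_1$ and $\rho_2\sim\sigma_2$. Then $\mathcal{A}_1\otimes\mathcal{A}_2$ is $(\epsilon_1+\epsilon_2,\bar\delta)$-differentially private on such product states, with $$\bar\delta=\min\{\delta_1+e^{\epsilon_1}\delta_2,\;e^{\epsilon_2}\delta_1+\delta_2\}.$$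
   Context: All Hilbert spaces are finite-dimensional. A quantum algorithm (or channel) is a completely positive trace-preserving map. Let $\mathcal{D}$ be a set of quantum states with a neighbouring relation $\sim$, and $\epsilon,\delta\ge0$. A quantum algorithm $\mathcal{A}$ is $(\epsilon,\delta)$-differentially private (with respect to $\mathcal{D},\sim$) if for all operators $0\le M\le I$ and all $\rho,\sigma\in\mathcal{D}$ with $\rho\sim\sigma$, $\operatorname{Tr}(M\mathcal{A}(\rho))\le e^\epsilon\operatorname{Tr}(M\mathcal{A}(\sigma))+\delta$. In the parallel composition, $\mathcal{A}_1,\mathcal{A}_2$ have their own databases $\mathcal{D}_1,\mathcal{D}_2$ and neighbouring relations (both written $\sim$), and the database for $\mathcal{A}_1\otimes\mathcal{A}_2$ is $\{\rho_1\otimes\rho_2:\rho_i\in\mathcal{D}_i\}$. *)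

(* Defs.v *)
From HB Require Import structures.
From mathcomp Require Import all_boot all_order all_algebra.
From mathcomp Require Import spectral complex mxtens.
From mathcomp Require Import classical_sets reals sequences exp.

Set Implicit Arguments.
Unset Strict Implicit.
Unset Printing Implicit Defensive.

Import Order.TTheory GRing.Theory Num.Theory.
Local Open Scope classical_set_scope.
Local Open Scope complex_scope.
Local Open Scope sesquilinear_scope.
Local Open Scope ring_scope.

(* The Hilbert space of dimension n is C^n with C := R[i]; its operators are  *)
(* the matrices 'M[R[i]]_n, and tensor products of operators are Kronecker    *)
(* products, so that C^n1 (x) C^n2 is C^(n1 * n2).                            *)

(* On R[i], 0 <= z means that z is real and nonnegative, so that a positive   *)
(* semidefinite matrix is in particular Hermitian.                            *)
Definition psdmx (R : realType) (n : nat) (A : 'M[R[i]]_n) : Prop :=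
  forall v : 'cV[R[i]]_n, 0 <= (v^t* *m A *m v) 0 0.

Definition lownermx (R : realType) (n : nat) (A B : 'M[R[i]]_n) : Prop :=
  psdmx (B - A).

Definition density (R : realType) (n : nat) : set 'M[R[i]]_n :=
  [set rho | psdmx rho /\ \tr rho = 1].

(* The linear map Phi1 (x) Phi2, obtained by expanding X on the matrix units  *)
(* tensmx (delta_mx i1 j1) (delta_mx i2 j2); tensmapE characterizes it.       *)
Definition tensmap (R : realType) (n1 m1 n2 m2 : nat)
    (Phi1 : {linear 'M[R[i]]_n1 -> 'M[R[i]]_m1})
    (Phi2 : {linear 'M[R[i]]_n2 -> 'M[R[i]]_m2})
    (X : 'M[R[i]]_(n1 * n2)) : 'M[R[i]]_(m1 * m2) :=
  \sum_(i1 < n1) \sum_(j1 < n1) \sum_(i2 < n2) \sum_(j2 < n2)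
    X (mxtens_index (i1, i2)) (mxtens_index (j1, j2)) *:
      tensmx (Phi1 (delta_mx i1 j1)) (Phi2 (delta_mx i2 j2)).

Lemma tensmap_is_linear (R : realType) (n1 m1 n2 m2 : nat)
    (Phi1 : {linear 'M[R[i]]_n1 -> 'M[R[i]]_m1})
    (Phi2 : {linear 'M[R[i]]_n2 -> 'M[R[i]]_m2}) :
  linear (tensmap Phi1 Phi2).
Proof.
move=> a X Y; rewrite /tensmap.
do 4![rewrite scaler_sumr -big_split /=; apply: eq_bigr => ? _].
by rewrite !mxE scalerDl scalerA.
Qed.

HB.instance Definition _ (R : realType) (n1 m1 n2 m2 : nat)
    (Phi1 : {linear 'M[R[i]]_n1 -> 'M[R[i]]_m1})
    (Phi2 : {linear 'M[R[i]]_n2 -> 'M[R[i]]_m2}) :=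
  GRing.isLinear.Build R[i] 'M[R[i]]_(n1 * n2) 'M[R[i]]_(m1 * m2) *:%R
    (tensmap Phi1 Phi2) (tensmap_is_linear Phi1 Phi2).

Lemma tensmapE (R : realType) (n1 m1 n2 m2 : nat)
    (Phi1 : {linear 'M[R[i]]_n1 -> 'M[R[i]]_m1})
    (Phi2 : {linear 'M[R[i]]_n2 -> 'M[R[i]]_m2})
    (X : 'M[R[i]]_n1) (Y : 'M[R[i]]_n2) :
  tensmap Phi1 Phi2 (tensmx X Y) = tensmx (Phi1 X) (Phi2 Y).
Proof.
have expand n m (Phi : {linear 'M[R[i]]_n -> 'M[R[i]]_m}) Z k l :
    Phi Z k l = \sum_i \sum_j Z i j * Phi (delta_mx i j) k l.
  rewrite {1}(matrix_sum_delta Z) linear_sum summxE.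
  apply: eq_bigr => i _; rewrite linear_sum summxE.
  by apply: eq_bigr => j _; rewrite linearZ mxE.
apply/matrixP => k l.
case: (mxtens_indexP k) => k1 k2; case: (mxtens_indexP l) => l1 l2.
rewrite tensmxE (expand _ _ Phi1) (expand _ _ Phi2) /tensmap summxE mulr_suml.
apply: eq_bigr => i1 _; rewrite summxE mulr_suml.
apply: eq_bigr => j1 _; rewrite summxE mulr_sumr.
apply: eq_bigr => i2 _; rewrite summxE mulr_sumr.
by apply: eq_bigr => j2 _; rewrite mxE !tensmxE mulrACA.
Qed.

Definition completely_positive (R : realType) (n m : nat)
    (Phi : {linear 'M[R[i]]_n -> 'M[R[i]]_m}) : Prop :=
  forall (k : nat) (X : 'M[R[i]]_(k * n)),
    psdmx X -> psdmx (tensmap (@idfun 'M[R[i]]_k) Phi X).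

Definition trace_preserving (R : realType) (n m : nat)
    (Phi : {linear 'M[R[i]]_n -> 'M[R[i]]_m}) : Prop :=
  forall X : 'M[R[i]]_n, \tr (Phi X) = \tr X.

Definition quantum_channel (R : realType) (n m : nat)
    (Phi : {linear 'M[R[i]]_n -> 'M[R[i]]_m}) : Prop :=
  completely_positive Phi /\ trace_preserving Phi.

(* Differential privacy is a notion about quantum algorithms, so that it      *)
(* includes being a quantum channel. For such an A, both sides of the         *)
(* inequality below are real, and <= on R[i] is the order of the reals.       *)
Definition diff_private (R : realType) (n m : nat) (eps delta : R)
    (D : set 'M[R[i]]_n) (nb : 'M[R[i]]_n -> 'M[R[i]]_n -> Prop)
    (A : {linear 'M[R[i]]_n -> 'M[R[i]]_m}) : Prop :=
  quantum_channel A /\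
  forall M : 'M[R[i]]_m, lownermx 0 M -> lownermx M 1%:M ->
  forall rho sigma : 'M[R[i]]_n, D rho -> D sigma -> nb rho sigma ->
    \tr (M *m A rho) <= (expR eps)%:C * \tr (M *m A sigma) + delta%:C.

Definition tens_database (R : realType) (n1 n2 : nat)
    (D1 : set 'M[R[i]]_n1) (D2 : set 'M[R[i]]_n2) : set 'M[R[i]]_(n1 * n2) :=
  [set tensmx rho1 rho2 | rho1 in D1 & rho2 in D2].

(* The factors range over the databases, outside of which nb1 and nb2 are     *)
(* meaningless; a product of density matrices determines its factors.         *)
Definition tens_neighbour (R : realType) (n1 n2 : nat)
    (D1 : set 'M[R[i]]_n1) (nb1 : 'M[R[i]]_n1 -> 'M[R[i]]_n1 -> Prop)
    (D2 : set 'M[R[i]]_n2) (nb2 : 'M[R[i]]_n2 -> 'M[R[i]]_n2 -> Prop)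
    (rho sigma : 'M[R[i]]_(n1 * n2)) : Prop :=
  exists rho1 sigma1 rho2 sigma2,
    [/\ [/\ D1 rho1, D1 sigma1, D2 rho2 & D2 sigma2],
        rho = tensmx rho1 rho2, sigma = tensmx sigma1 sigma2,
        nb1 rho1 sigma1 & nb2 rho2 sigma2].

(* Main.v *)
(* A positive trace-preserving map F preserves the privacy inequality: its    *)
(* adjoint for the trace pairing sends effects 0 <= M <= 1 to effects, and    *)
(* Tr(M F(X)) = Tr(F^*(M) X). This is post-processing. For the parallel       *)
(* composition, apply it to X |-> X (x) A2(rho2) and X |-> A1(sigma1) (x) X,  *)
(* and chain the two inequalities through the intermediate state              *)
(* A1(sigma1) (x) A2(rho2); the intermediate state A1(rho1) (x) A2(sigma2)    *)
(* gives the other term of the minimum. That A1 (x) A2 is completely positive *)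
(* follows from Kraus decompositions of A1 and A2.                            *)

Require Import Defs.
From HB Require Import structures.
From mathcomp Require Import all_boot all_order all_algebra.
From mathcomp Require Import spectral complex mxtens.
From mathcomp Require Import classical_sets reals sequences exp.

Set Implicit Arguments.
Unset Strict Implicit.
Unset Printing Implicit Defensive.

Import Order.TTheory GRing.Theory Num.Theory.
Local Open Scope classical_set_scope.
Local Open Scope complex_scope.
Local Open Scope sesquilinear_scope.
Local Open Scope ring_scope.

(** By the spectral theorem a positive matrix is a Gram matrix [B *m B^t*] ([psdmx_factor]), which
    gives the positivity of tensor products and of trace pairings. Applied to the Choi matrix, the
    same factorization produces Kraus operators ([completely_positive_kraus]), and tensoring these
    shows that a tensor product of channels is a channel. Privacy is treated one pair of outputs at
    a time: [private_pair_image] transports it along a positive trace-preserving map, and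
    [private_pair_trans] chains two such inequalities. *)

Lemma adjmx_mul (C : numClosedFieldType) m n p
    (A : 'M[C]_(m, n)) (B : 'M[C]_(n, p)) :
  (A *m B)^t* = B^t* *m A^t*.
Proof. by rewrite trmx_mul map_mxM. Qed.

Lemma adjmx_tens (C : numClosedFieldType) m n p q
    (A : 'M[C]_(m, n)) (B : 'M[C]_(p, q)) :
  (A *t B)^t* = A^t* *t B^t*.
Proof. by rewrite trmx_tens map_mxT. Qed.

Lemma adjmx_delta (C : numClosedFieldType) m n (i : 'I_m) (j : 'I_n) :
  (delta_mx i j : 'M[C]_(m, n))^t* = delta_mx j i.
Proof. by rewrite trmx_delta map_delta_mx. Qed.

Lemma adjmx_sum (C : numClosedFieldType) m n (I : finType)
    (A : I -> 'M[C]_(m, n)) :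
  (\sum_i A i)^t* = \sum_i (A i)^t*.
Proof. by rewrite !raddf_sum. Qed.

Lemma tens_delta_mx (C : comPzRingType) m n p q
    (i : 'I_m) (j : 'I_n) (k : 'I_p) (l : 'I_q) :
  delta_mx i j *t delta_mx k l =
  delta_mx (mxtens_index (i, k)) (mxtens_index (j, l)) :> 'M[C]_(m * p, n * q).
Proof.
apply/matrixP => x y.
case: (mxtens_indexP x) => x1 x2; case: (mxtens_indexP y) => y1 y2.
rewrite tensmxE !mxE !(can_eq (@mxtens_indexK _ _)) !xpair_eqE.
by rewrite -natrM mulnb andbACA.
Qed.

Lemma mxtrace_tens (C : comPzRingType) m n (A : 'M[C]_m) (B : 'M[C]_n) :
  \tr (A *t B) = \tr A * \tr B.
Proof. by rewrite /mxtrace mulr_sum; apply: eq_bigr => i _; rewrite mxE. Qed.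

(** Tensors of matrix units are exactly the matrix units of the product space, so product matrices
    span it. Identities about [tensmap] are thereby reduced to [tensmapE]. *)
Lemma linear_tens_ext (C : comNzRingType) m n p q (V : lmodType C)
    (F G : {linear 'M[C]_(m * p, n * q) -> V}) :
  (forall A B, F (A *t B) = G (A *t B)) -> F =1 G.
Proof.
move=> eqFG X; rewrite (matrix_sum_delta X) !linear_sum.
apply: eq_bigr => k _; rewrite !linear_sum; apply: eq_bigr => l _.
rewrite !linearZ /=.
case: (mxtens_indexP k) => k1 k2; case: (mxtens_indexP l) => l1 l2.
by rewrite -tens_delta_mx eqFG.
Qed.

(** With [A = P^t* D P] and [P] unitary, [v] is the unit eigenvector [P^t* e_i]. Signs of
    eigenvalues can thus be read off the quadratic form. *)
Lemma normal_spectral_diagE (C : numClosedFieldType) n (A : 'M[C]_n) i :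
  A \is normalmx ->
  let v : 'cV_n := (spectralmx A)^t* *m delta_mx i 0 in
  spectral_diag A 0 i = (v^t* *m A *m v) 0 0.
Proof.
move=> /orthomx_spectralP; rewrite invmx_unitary ?spectral_unitarymx//.
move=> eqA v; rewrite {2}eqA /v adjmx_mul trmxCK adjmx_delta.
have /unitarymxP PP := spectral_unitarymx A.
rewrite !mulmxA -(mulmxA (delta_mx 0 i)) PP mulmx1.
rewrite -!mulmxA (mulmxA (spectralmx A)) PP mul1mx.
by rewrite -rowE -colE !mxE eqxx mulr1n.
Qed.

Section PrivacyOfChannels.
Variable R : realType.
Local Notation C := R[i].

(** * Positive semidefinite matrices *)

Lemma psdmx_conj m n (K : 'M[C]_(m, n)) (A : 'M[C]_n) :
  psdmx A -> psdmx (K *m A *m K^t*).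
Proof.
by move=> A_ge0 v; have := A_ge0 (K^t* *m v); rewrite adjmx_mul trmxCK !mulmxA.
Qed.

Lemma psdmx1 n : psdmx (1%:M : 'M[C]_n).
Proof.
move=> v; rewrite mulmx1 mxE sumr_ge0// => i _.
by rewrite !mxE mulrC mul_conjC_ge0.
Qed.

Lemma psdmx_gram m n (B : 'M[C]_(m, n)) : psdmx (B *m B^t*).
Proof. by have := psdmx_conj B (@psdmx1 n); rewrite mulmx1. Qed.

Lemma psdmx_sum n (I : finType) (A : I -> 'M[C]_n) :
  (forall i, psdmx (A i)) -> psdmx (\sum_i A i).
Proof.
move=> A_ge0 v; rewrite mulmx_sumr mulmx_suml summxE.
by apply: sumr_ge0 => i _; exact: A_ge0.
Qed.

(* The skew-Hermitian part of A is normal and its quadratic form vanishes, so *)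
(* that all its eigenvalues do.                                               *)
Lemma psdmx_adj n (A : 'M[C]_n) : psdmx A -> A^t* = A.
Proof.
move=> A_ge0; pose S := A - A^t*.
have adjS : S^t* = - S by rewrite /S linearB raddfB/= trmxCK opprB.
have Snormal : S \is normalmx.
  by apply/normalmxP; rewrite adjS mulmxN mulNmx.
have qS (v : 'cV_n) : (v^t* *m S *m v) 0 0 = 0.
  have -> : v^t* *m S *m v = v^t* *m A *m v - (v^t* *m A *m v)^t*.
    by rewrite !adjmx_mul trmxCK mulmxBr mulmxBl mulmxA.
  move: (A_ge0 v); move: (v^t* *m A *m v) => q q_ge0.
  by rewrite !mxE geC0_conj ?subrr.
suff S0 : S = 0 by apply/esym/eqP; rewrite -subr_eq0 -/S S0.
have diag0 : spectral_diag S = 0.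
  by apply/rowP => i; rewrite normal_spectral_diagE// qS mxE.
have /orthomx_spectralP -> := Snormal.
by rewrite diag0 linear0 mulmx0 mul0mx.
Qed.

(** The eigenvalues are nonnegative, so their square roots [s] are real and [B = P^t* diag(s)]
    works, where [P] diagonalizes [A]. *)
Lemma psdmx_factor n (A : 'M[C]_n) :
  psdmx A -> exists B : 'M[C]_n, A = B *m B^t*.
Proof.
move=> A_ge0.
have Anormal : A \is normalmx by apply/normalmxP; rewrite psdmx_adj.
set d := spectral_diag A.
have d_ge0 i : 0 <= d 0 i by rewrite /d normal_spectral_diagE.
pose s : 'rV_n := map_mx sqrtC d.
exists ((spectralmx A)^t* *m diag_mx s).
rewrite adjmx_mul trmxCK tr_diag_mx map_diag_mx.
rewrite mulmxA -[X in X *m _]mulmxA mulmx_diag.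
have -> : \row_j (s 0 j * (map_mx Num.conj s) 0 j) = d.
  apply/rowP => i; rewrite !mxE geC0_conj ?sqrtC_ge0//.
  by rewrite -expr2 sqrtCK.
by rewrite -invmx_unitary ?spectral_unitarymx//; apply/orthomx_spectralP.
Qed.

Lemma psdmx_tens m n (A : 'M[C]_m) (B : 'M[C]_n) :
  psdmx A -> psdmx B -> psdmx (A *t B).
Proof.
move=> /psdmx_factor[A' ->] /psdmx_factor[B' ->].
by rewrite -tensmx_mul -adjmx_tens; exact: psdmx_gram.
Qed.

(** Once [B] is factored, cyclicity turns the trace into the sum of the quadratic form of [A] over
    the columns of the factor. *)
Lemma mxtrace_psdmx_mul n (A B : 'M[C]_n) :
  psdmx A -> psdmx B -> 0 <= \tr (A *m B).
Proof.
move=> A_ge0 /psdmx_factor[{}B ->].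
rewrite mulmxA mxtrace_mulC mulmxA /mxtrace sumr_ge0// => i _.
have := A_ge0 (B *m delta_mx i 0).
by rewrite adjmx_mul adjmx_delta !mulmxA -colE -!mulmxA -rowE !mulmxA !mxE.
Qed.

Lemma mxtrace_gram n (v : 'cV[C]_n) (A : 'M[C]_n) :
  \tr (A *m (v *m v^t*)) = (v^t* *m A *m v) 0 0.
Proof.
by rewrite mulmxA mxtrace_mulC mulmxA [LHS]big_ord_recl big_ord0 addr0.
Qed.

(** * The adjoint of a positive trace-preserving map *)

Section Pullback.
Variables (m n : nat) (F : {linear 'M[C]_m -> 'M[C]_n}).

(* The Heisenberg-picture adjoint of F. *)
Definition pullback (M : 'M[C]_n) : 'M[C]_m :=
  \matrix_(i, j) \tr (M *m F (delta_mx j i)).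

Lemma mxtrace_pullback M X : \tr (pullback M *m X) = \tr (M *m F X).
Proof.
rewrite [in RHS](matrix_sum_delta X) linear_sum mulmx_sumr raddf_sum.
rewrite /mxtrace; under eq_bigr do rewrite mxE.
rewrite exchange_big; apply: eq_bigr => j _ /=.
rewrite linear_sum mulmx_sumr [RHS]raddf_sum; apply: eq_bigr => i _ /=.
by rewrite mxE linearZ/= -scalemxAr [RHS]linearZ/= mulrC.
Qed.

Hypothesis F_pos : forall X, psdmx X -> psdmx (F X).
Hypothesis F_tr : trace_preserving F.

Lemma pullback_effect M : lownermx 0 M -> lownermx M 1%:M ->
  lownermx 0 (pullback M) /\ lownermx (pullback M) 1%:M.
Proof.
rewrite /lownermx !subr0 => M_ge0 M_le1; split=> v.
  rewrite -mxtrace_gram mxtrace_pullback.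
  by apply: mxtrace_psdmx_mul => //; apply/F_pos/psdmx_gram.
(* Trace preservation replaces the trace of [v *m v^t*] by that of its image, so the form becomes
   the pairing of [1 - M] with a positive matrix. *)
rewrite -mxtrace_gram mulmxBl raddfB/= mxtrace_pullback mul1mx -F_tr.
rewrite -[X in \tr X - _]mul1mx -raddfB/= -mulmxBl.
by apply: mxtrace_psdmx_mul => //; apply/F_pos/psdmx_gram.
Qed.

End Pullback.

(** * Kraus operators and Choi's theorem *)

Section Kraus.

Definition kraus_form m n (I : finType) (K : I -> 'M[C]_(n, m))
    (F : 'M[C]_m -> 'M[C]_n) : Prop :=
  forall X, F X = \sum_l K l *m X *m (K l)^t*.

Lemma kraus_psdmx m n (I : finType) (K : I -> 'M[C]_(n, m)) F X :
  kraus_form K F -> psdmx X -> psdmx (F X).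
Proof. by move=> -> X_ge0; apply: psdmx_sum => l; exact: psdmx_conj. Qed.

Lemma kraus_idfun n :
  kraus_form (fun _ : unit => 1%:M) (@idfun 'M[C]_n).
Proof.
move=> X; rewrite (big_pred1 tt); last by case.
by rewrite mul1mx trmx1 map_mx1 mulmx1.
Qed.

Lemma kraus_tensmap n1 m1 n2 m2 (I J : finType)
    (K : I -> 'M[C]_(m1, n1)) (L : J -> 'M[C]_(m2, n2))
    (F : {linear 'M[C]_n1 -> 'M[C]_m1}) (G : {linear 'M[C]_n2 -> 'M[C]_m2}) :
  kraus_form K F -> kraus_form L G ->
  kraus_form (fun l : I * J => K l.1 *t L l.2) (tensmap F G).
Proof.
move=> FK GL X.
pose S0 Y := \sum_(l : I * J) (K l.1 *t L l.2) *m Y *m (K l.1 *t L l.2)^t*.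
have S0_linear : linear S0.
  move=> a Y Z; rewrite scaler_sumr -big_split; apply: eq_bigr => l _ /=.
  by rewrite mulmxDr mulmxDl -scalemxAr -scalemxAl.
(* The Kraus sum is bundled as a linear map so that comparing it with [tensmap F G] on product
   matrices suffices. *)
pose S : {linear 'M[C]_(n1 * n2) -> 'M[C]_(m1 * m2)} :=
  HB.pack S0 (GRing.isLinear.Build _ _ _ _ _ S0_linear).
rewrite -[RHS]/(S X); apply: linear_tens_ext => A B.
rewrite /= tensmapE FK GL /S0.
apply/matrixP => i j.
case: (mxtens_indexP i) => i1 i2; case: (mxtens_indexP j) => j1 j2.
rewrite tensmxE !summxE mulr_suml.
under eq_bigr do rewrite mulr_sumr.
rewrite pair_big; apply: eq_bigr => l _ /=.
by rewrite adjmx_tens !tensmx_mul tensmxE.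
Qed.

Lemma kraus_completely_positive m n (I : finType) (K : I -> 'M[C]_(n, m))
    (F : {linear 'M[C]_m -> 'M[C]_n}) :
  kraus_form K F -> completely_positive F.
Proof.
by move=> FK k X; apply: kraus_psdmx (kraus_tensmap (@kraus_idfun k) FK).
Qed.

(* Choi's theorem: the Choi matrix (id (x) F)(w w^* ) with                    *)
(* w = \sum_i e_i (x) e_i factors as B B^*, and the columns of B, reshaped,   *)
(* are the Kraus operators.                                                   *)
Lemma completely_positive_kraus m n (F : {linear 'M[C]_m -> 'M[C]_n}) :
  completely_positive F ->
  exists (I : finType) (K : I -> 'M[C]_(n, m)), kraus_form K F.
Proof.
move=> F_cp; pose e (i : 'I_m) : 'cV[C]_m := delta_mx i 0.
pose w : 'M[C]_(m * m, 1 * 1) := \sum_i e i *t e i.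
have [B choiE] := psdmx_factor (F_cp _ _ (psdmx_gram w)).
have wE : w *m w^t* = \sum_i \sum_j delta_mx i j *t delta_mx i j.
  rewrite /w adjmx_sum mulmx_suml; apply: eq_bigr => i _.
  rewrite mulmx_sumr; apply: eq_bigr => j _.
  by rewrite adjmx_tens adjmx_delta tensmx_mul mul_delta_mx.
(* The [(i, j)] block of the Choi matrix is [F (delta_mx i j)]; its entries are read from the
   factorization. *)
have FE i j a b : F (delta_mx i j) a b =
    \sum_r B (mxtens_index (i, a)) r * (B (mxtens_index (j, b)) r)^*%R.
  have /matrixP/(_ (mxtens_index (i, a)) (mxtens_index (j, b))) := choiE.
  rewrite [RHS]mxE; under [in RHS]eq_bigr do rewrite !mxE.
  have tensE k l : tensmap (@idfun 'M[C]_m) F (delta_mx k l *t delta_mx k l)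
      (mxtens_index (i, a)) (mxtens_index (j, b)) =
      ((i == k) && (j == l))%:R * F (delta_mx k l) a b.
    by rewrite (tensmapE (@idfun 'M[C]_m) F) tensmxE /= mxE.
  move=> <-; rewrite wE linear_sum summxE (bigD1 i)//= linear_sum summxE.
  rewrite (bigD1 j)//= tensE !eqxx mul1r !big1 ?addr0//.
    move=> k ki; rewrite linear_sum summxE big1// => l _.
    by rewrite tensE eq_sym (negPf ki) mul0r.
  by move=> l lj; rewrite tensE [j == l]eq_sym (negPf lj) andbF mul0r.
exists 'I_(m * n), (fun r => \matrix_(a, i) B (mxtens_index (i, a)) r) => X.
rewrite [in LHS](matrix_sum_delta X) linear_sum; apply/matrixP => a b.
rewrite !summxE.
transitivity (\sum_i \sum_j \sum_r
    X i j * (B (mxtens_index (i, a)) r * (B (mxtens_index (j, b)) r)^*%R)).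
  apply: eq_bigr => i _; rewrite linear_sum summxE; apply: eq_bigr => j _.
  by rewrite linearZ mxE FE mulr_sumr.
rewrite exchange_big /=.
under eq_bigr do rewrite exchange_big /=.
rewrite exchange_big /=; apply: eq_bigr => r _.
rewrite mxE; apply: eq_bigr => j _; rewrite !mxE mulr_suml.
by apply: eq_bigr => i _; rewrite !mxE mulrCA mulrA.
Qed.

End Kraus.

(** * Closure properties of channels *)

Lemma completely_positive_psdmx m n (F : {linear 'M[C]_m -> 'M[C]_n}) X :
  completely_positive F -> psdmx X -> psdmx (F X).
Proof. by move=> /completely_positive_kraus[I [K /kraus_psdmx]]; exact. Qed.

Lemma completely_positive_comp m n p (F : {linear 'M[C]_m -> 'M[C]_n})
    (G : {linear 'M[C]_n -> 'M[C]_p}) :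
  completely_positive F -> completely_positive G ->
  completely_positive (G \o F).
Proof.
move=> F_cp G_cp k X /F_cp/G_cp; congr psdmx.
pose H : {linear 'M[C]_(k * m) -> 'M[C]_(k * p)} :=
  tensmap (@idfun 'M[C]_k) G \o tensmap (@idfun 'M[C]_k) F.
rewrite -[LHS]/(H X); apply: linear_tens_ext => A B.
by rewrite /H /= !tensmapE.
Qed.

Lemma quantum_channel_comp m n p (F : {linear 'M[C]_m -> 'M[C]_n})
    (G : {linear 'M[C]_n -> 'M[C]_p}) :
  quantum_channel F -> quantum_channel G -> quantum_channel (G \o F).
Proof.
move=> [F_cp F_tr] [G_cp G_tr]; split; first exact: completely_positive_comp.
by move=> X /=; rewrite G_tr F_tr.
Qed.

Lemma quantum_channel_tensmap n1 m1 n2 m2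
    (F : {linear 'M[C]_n1 -> 'M[C]_m1}) (G : {linear 'M[C]_n2 -> 'M[C]_m2}) :
  quantum_channel F -> quantum_channel G -> quantum_channel (tensmap F G).
Proof.
move=> [F_cp F_tr] [G_cp G_tr]; split.
  have [I [K FK]] := completely_positive_kraus F_cp.
  have [J [L GL]] := completely_positive_kraus G_cp.
  exact: kraus_completely_positive (kraus_tensmap FK GL).
move=> X.
(* [C^o] is the field as a module over itself, which makes both traces linear maps that can be
   compared on product matrices. *)
pose trF : {linear 'M[C]_(n1 * n2) -> C^o} := @mxtrace _ _ \o tensmap F G.
pose tr0 : {linear 'M[C]_(n1 * n2) -> C^o} := @mxtrace _ _.
apply: (@linear_tens_ext _ _ _ _ _ _ trF tr0) => A B.
by rewrite /trF /tr0 /= tensmapE !mxtrace_tens F_tr G_tr.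
Qed.

(** * Transporting and chaining the privacy inequality *)

Section Parallel.
Variables (m1 m2 : nat).

Definition tens_right (T : 'M[C]_m2) (X : 'M[C]_m1) : 'M[C]_(m1 * m2) := X *t T.
Definition tens_left (T : 'M[C]_m1) (X : 'M[C]_m2) : 'M[C]_(m1 * m2) := T *t X.

Lemma tens_right_is_linear T : linear (tens_right T).
Proof. by move=> a X Y; apply/matrixP => i j; rewrite !mxE mulrDl mulrA. Qed.

Lemma tens_left_is_linear T : linear (tens_left T).
Proof. by move=> a X Y; apply/matrixP => i j; rewrite !mxE mulrDr mulrCA. Qed.

HB.instance Definition _ T :=
  GRing.isLinear.Build C _ _ _ (tens_right T) (tens_right_is_linear T).
HB.instance Definition _ T :=
  GRing.isLinear.Build C _ _ _ (tens_left T) (tens_left_is_linear T).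

End Parallel.

Definition private_pair n (eps delta : R) (rho sigma : 'M[C]_n) : Prop :=
  forall M, lownermx 0 M -> lownermx M 1%:M ->
    \tr (M *m rho) <= (expR eps)%:C * \tr (M *m sigma) + delta%:C.

Lemma private_pair_image m n (F : {linear 'M[C]_m -> 'M[C]_n})
    eps delta rho sigma :
  (forall X, psdmx X -> psdmx (F X)) -> trace_preserving F ->
  private_pair eps delta rho sigma -> private_pair eps delta (F rho) (F sigma).
Proof.
move=> F_pos F_tr priv M M_ge0 M_le1.
have [N_ge0 N_le1] := pullback_effect F_pos F_tr M_ge0 M_le1.
by rewrite -!mxtrace_pullback; exact: priv.
Qed.

(** The second inequality is substituted into the first, hence multiplied by [expR eps1]. This
    asymmetry is the source of the two terms of the minimum. *)
Lemma private_pair_trans n eps1 delta1 eps2 delta2 (rho tau sigma : 'M[C]_n) :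
  private_pair eps1 delta1 rho tau -> private_pair eps2 delta2 tau sigma ->
  private_pair (eps1 + eps2) (delta1 + expR eps1 * delta2) rho sigma.
Proof.
move=> priv1 priv2 M M_ge0 M_le1; apply: le_trans (priv1 _ M_ge0 M_le1) _.
rewrite expRD !rmorphD !rmorphM /= [X in _ <= _ + X]addrC addrA lerD2r.
rewrite -mulrA -mulrDr.
by rewrite ler_pM2l ?ltcR ?expR_gt0//; exact: priv2.
Qed.

Lemma private_pair_tensr m1 m2 eps delta (rho sigma : 'M[C]_m1)
    (tau : 'M[C]_m2) :
  density tau -> private_pair eps delta rho sigma ->
  private_pair eps delta (rho *t tau) (sigma *t tau).
Proof.
move=> [tau_ge0 tau1]; apply: (@private_pair_image _ _ (tens_right tau)).
  by move=> X X_ge0; exact: psdmx_tens.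
by move=> X; rewrite mxtrace_tens tau1 mulr1.
Qed.

Lemma private_pair_tensl m1 m2 eps delta (rho sigma : 'M[C]_m2)
    (tau : 'M[C]_m1) :
  density tau -> private_pair eps delta rho sigma ->
  private_pair eps delta (tau *t rho) (tau *t sigma).
Proof.
move=> [tau_ge0 tau1]; apply: (@private_pair_image _ _ (tens_left tau)).
  by move=> X X_ge0; exact: psdmx_tens.
by move=> X; rewrite mxtrace_tens tau1 mul1r.
Qed.

Lemma density_channel m n (F : {linear 'M[C]_m -> 'M[C]_n}) rho :
  quantum_channel F -> density rho -> density (F rho).
Proof.
move=> [F_cp F_tr] [rho_ge0 rho1]; split; last by rewrite F_tr.
exact: completely_positive_psdmx.
Qed.

End PrivacyOfChannels.

Theorem mainTheorem4 (R : realType) :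
  (forall (n m p : nat) (eps delta : R)
     (D : set 'M[R[i]]_n) (nb : 'M[R[i]]_n -> 'M[R[i]]_n -> Prop)
     (A : {linear 'M[R[i]]_n -> 'M[R[i]]_m})
     (N : {linear 'M[R[i]]_m -> 'M[R[i]]_p}),
     0 <= eps -> 0 <= delta -> D `<=` @density R n ->
     diff_private eps delta D nb A -> quantum_channel N ->
     diff_private eps delta D nb (N \o A)) /\
  (forall (n1 m1 n2 m2 : nat) (eps1 delta1 eps2 delta2 : R)
     (D1 : set 'M[R[i]]_n1) (nb1 : 'M[R[i]]_n1 -> 'M[R[i]]_n1 -> Prop)
     (D2 : set 'M[R[i]]_n2) (nb2 : 'M[R[i]]_n2 -> 'M[R[i]]_n2 -> Prop)
     (A1 : {linear 'M[R[i]]_n1 -> 'M[R[i]]_m1})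
     (A2 : {linear 'M[R[i]]_n2 -> 'M[R[i]]_m2}),
     0 <= eps1 -> 0 <= delta1 -> 0 <= eps2 -> 0 <= delta2 ->
     D1 `<=` @density R n1 -> D2 `<=` @density R n2 ->
     diff_private eps1 delta1 D1 nb1 A1 ->
     diff_private eps2 delta2 D2 nb2 A2 ->
     diff_private (eps1 + eps2)
       (Num.min (delta1 + expR eps1 * delta2) (expR eps2 * delta1 + delta2))
       (tens_database D1 D2) (tens_neighbour D1 nb1 D2 nb2)
       (tensmap A1 A2)).
Proof.
split.
  move=> n m p eps delta D nb A N _ _ _ [A_ch A_priv] N_ch.
  split; first exact: quantum_channel_comp.
  move=> M M_ge0 M_le1 rho sigma Drho Dsigma nbrs.
  have [N_cp N_tr] := N_ch.
  apply: private_pair_image N_tr _ M M_ge0 M_le1.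
    by move=> X; exact: completely_positive_psdmx.
  by move=> M' *; exact: A_priv.
move=> n1 m1 n2 m2 eps1 delta1 eps2 delta2 D1 nb1 D2 nb2 A1 A2 _ _ _ _ D1d D2d.
move=> [A1_ch A1_priv] [A2_ch A2_priv].
split; first exact: quantum_channel_tensmap.
move=> M M_ge0 M_le1 rho sigma _ _ [rho1 [sigma1 [rho2 [sigma2]]]].
move=> [[Dr1 Ds1 Dr2 Ds2] {rho}-> {sigma}-> nbrs1 nbrs2]; rewrite /= !tensmapE.
have priv1 : private_pair eps1 delta1 (A1 rho1) (A1 sigma1).
  by move=> M' *; exact: A1_priv.
have priv2 : private_pair eps2 delta2 (A2 rho2) (A2 sigma2).
  by move=> M' *; exact: A2_priv.
have dens1 rho : D1 rho -> density (A1 rho).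
  by move=> /D1d; exact: density_channel.
have dens2 rho : D2 rho -> density (A2 rho).
  by move=> /D2d; exact: density_channel.
(* Both bounds hold, whichever is smaller: here the first factor is changed before the second. *)
rewrite minEle; case: ifP => _.
  apply: private_pair_trans M M_ge0 M_le1.
    by apply: private_pair_tensr priv1; exact: dens2.
  by apply: private_pair_tensl priv2; exact: dens1.
(* Changing the second factor first exchanges the roles of the two parameter pairs; the sums are
   reordered to match [private_pair_trans]. *)
rewrite (addrC eps1) (addrC _ delta2).
apply: private_pair_trans M M_ge0 M_le1.
  by apply: private_pair_tensl priv2; exact: dens1.
by apply: private_pair_tensr priv1; exact: dens2.
Qed.
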